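(* Let $n\ge1$ and assume that the elements $\sigma_1,\dots,\sigma_n\in\bar U(n)$ satisfy the system $$\tilde h_{ij}\,\Delta_j\sigma_i=\sigma_i-\sigma_j,\qquad i,j=1,\dots,n.$$ Then there exists an element $\sigma\in\bar U(n)$ such that $\sigma_i=\Delta_i\sigma$ for $i=1,\dots,n$.
   Context: $\mathbb K$ is a field of characteristic $0$. $U(n)=\mathbb K[\tilde h_1,\dots,\tilde h_n]$ is the commutative polynomial ring, $\tilde h_{ij}=\tilde h_i-\tilde h_j$, and $\bar U(n)$ is the localization of $U(n)$ with respect to the multiplicative set generated by all $\tilde h_{ij}+a$, $a\in\mathbb Z$, $i\ne j$. For $p\in\bar U(n)$, $p[-\varepsilon_j]$ denotes the image of $p$ under the automorphism $\tilde h_i\mapsto\tilde h_i-\delta_{ij}$ ($i=1,\dots,n$). $\Delta_j f:=f-f[-\varepsilon_j]$. *)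

(* Defs.v *)
From HB Require Import structures.
From mathcomp Require Import all_boot all_order all_algebra.
From mathcomp Require Import fraction mpoly ring.

Set Implicit Arguments.
Unset Strict Implicit.
Unset Printing Implicit Defensive.

Import GRing.Theory.
Local Open Scope ring_scope.
Local Open Scope quotient_scope.

Notation "x %:F" := (@FracField.tofrac _ x) : ring_scope.

Section Localization.
Variables (K : fieldType) (n : nat).

Notation U := {mpoly K[n]}.
Notation FU := {fraction {mpoly K[n]}}.
Implicit Types (p q : U) (x y : FU) (i j : 'I_n).

Definition htilde i : U := 'X_i.

Definition hdiff i j : U := htilde i - htilde j.

Inductive denom : U -> Prop :=
| denom1 : denom 1
| denomM i j (a : int) q :
    i != j -> denom q -> denom ((hdiff i j + a%:~R) * q).

(* U is a domain and elements of [denom] are nonzero (lemma [denom_neq0]), so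
   the localization is the subring of the fraction field consisting of the
   quotients p / q with q in the multiplicative set. *)
Definition Ubar x : Prop := exists p q, denom q /\ x = p%:F / q%:F.

Definition pshift j p : U := p \mPo [tuple htilde i - (i == j)%:R | i < n].

(* x[-eps_j], computed on a representative of the fraction x; lemma [shiftE]
   shows that the choice of the representative is irrelevant. *)
Definition shift j x : FU :=
  (pshift j \n_(repr x))%:F / (pshift j \d_(repr x))%:F.

Definition Delta j x : FU := x - shift j x.

Lemma pshiftD j : {morph pshift j : p q / p + q}.
Proof. by move=> p q; rewrite /pshift rmorphD. Qed.

Lemma pshiftM j : {morph pshift j : p q / p * q}.
Proof. by move=> p q; rewrite /pshift rmorphM. Qed.

Lemma pshift0 j : pshift j 0 = 0.
Proof. exact: rmorph0. Qed.

Lemma pshift1 j : pshift j 1 = 1.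
Proof. exact: rmorph1. Qed.

Lemma pshift_int j (a : int) : pshift j a%:~R = a%:~R.
Proof. exact: rmorph_int. Qed.

Lemma pshift_htilde j i : pshift j (htilde i) = htilde i - (i == j)%:R.
Proof. by rewrite /pshift /htilde comp_mpolyXU -tnth_nth tnth_mktuple. Qed.

Definition punshift j p : U := p \mPo [tuple htilde i + (i == j)%:R | i < n].

Lemma pshiftK j : cancel (pshift j) (punshift j).
Proof.
move=> p; rewrite /punshift /pshift; elim/mpolyind: p => [|c m p _ _ IH].
  by rewrite !rmorph0.
rewrite !rmorphD /= IH; congr (_ + _); rewrite !comp_mpolyZ; congr (_ *: _).
rewrite comp_mpolyX rmorph_prod [RHS]mpolyXE_id /=; apply: eq_bigr => i _.
rewrite rmorphXn /= tnth_mktuple rmorphB rmorph_nat /= comp_mpolyXU.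
by rewrite -tnth_nth tnth_mktuple addrK.
Qed.

Lemma punshiftK j : cancel (punshift j) (pshift j).
Proof.
move=> p; rewrite /punshift /pshift; elim/mpolyind: p => [|c m p _ _ IH].
  by rewrite !rmorph0.
rewrite !rmorphD /= IH; congr (_ + _); rewrite !comp_mpolyZ; congr (_ *: _).
rewrite comp_mpolyX rmorph_prod [RHS]mpolyXE_id /=; apply: eq_bigr => i _.
rewrite rmorphXn /= tnth_mktuple rmorphD rmorph_nat /= comp_mpolyXU.
by rewrite -tnth_nth tnth_mktuple subrK.
Qed.

Lemma pshift_eq0 j p : (pshift j p == 0) = (p == 0).
Proof. by rewrite -[X in _ == X](pshift0 j) (can_eq (pshiftK j)). Qed.

Lemma denom_neq0 q : denom q -> q != 0.
Proof.
elim=> [|i j a {}q ij _ q0]; first exact: oner_neq0.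
rewrite mulf_neq0 //; apply: contraNneq ij => /(congr1 (mcoeff U_(i)%MM)).
rewrite -(rmorph_int (@mpolyC n K)) mcoeffD mcoeffB !mcoeffXU mcoeffC mcoeff0.
rewrite mnm1_eq0 eqxx mulr0 addr0 eq_sym => /eqP.
by case: (i == j); rewrite // subr0 oner_eq0.
Qed.

Lemma denom_mul p q : denom p -> denom q -> denom (p * q).
Proof.
move=> + dq; elim=> [|i j a {}p ij _ dpq]; first by rewrite mul1r.
by rewrite -mulrA; apply: denomM.
Qed.

Lemma denom_pshift k q : denom q -> denom (pshift k q).
Proof.
elim=> [|i j a {}q ij _ dq]; first by rewrite pshift1; apply: denom1.
rewrite pshiftM; suff -> : pshift k (hdiff i j + a%:~R) =
    hdiff i j + (a - (i == k)%:Z + (j == k)%:Z)%:~R by apply: denomM.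
rewrite pshiftD pshift_int /hdiff /pshift rmorphB /= -!/(pshift _ _).
rewrite !pshift_htilde rmorphD rmorphB /= -!pmulrn.
by ring.
Qed.

Lemma Ubar_tofrac p : Ubar p%:F.
Proof. by exists p, 1; split; [exact: denom1 | rewrite rmorph1 divr1]. Qed.

Lemma UbarV q : denom q -> Ubar (q%:F)^-1.
Proof. by move=> dq; exists 1, q; rewrite rmorph1 mul1r. Qed.

Lemma UbarD x y : Ubar x -> Ubar y -> Ubar (x + y).
Proof.
move=> [p [q [dq ->]]] [r [s [ds ->]]]; exists (p * s + r * q), (q * s).
split; first exact: denom_mul.
by rewrite rmorphD !rmorphM /= addf_div // tofrac_eq0 denom_neq0.
Qed.

Lemma UbarM x y : Ubar x -> Ubar y -> Ubar (x * y).
Proof.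
move=> [p [q [dq ->]]] [r [s [ds ->]]]; exists (p * r), (q * s).
by split; [exact: denom_mul | rewrite !rmorphM /= mulf_div].
Qed.

Lemma UbarN x : Ubar x -> Ubar (- x).
Proof.
by move=> [p [q [dq ->]]]; exists (- p), q; split=> //; rewrite rmorphN mulNr.
Qed.

Lemma frac_repr x : x = (\n_(repr x))%:F / (\d_(repr x))%:F.
Proof.
have d0 := denom_ratioP (repr x).
apply: (canRL (mulfK _)); first by rewrite tofrac_eq0.
rewrite -[X in X * _](reprK x); unlock FracField.tofrac.
rewrite -[LHS]FracField.pi_mul; apply/eqmodP.
rewrite /= FracField.equivfE /FracField.mulf /=.
by rewrite !numden_Ratio ?mulf_neq0 ?oner_neq0 // !mulr1 mulrC.
Qed.

Lemma shiftE j p q : q != 0 ->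
  shift j (p%:F / q%:F) = (pshift j p)%:F / (pshift j q)%:F.
Proof.
move=> q0; rewrite /shift; move ex: (p%:F / q%:F) => x.
have d0 := denom_ratioP (repr x).
have /eqP := frac_repr x; rewrite -[X in X == _]ex.
rewrite eqr_div ?tofrac_eq0 // -!rmorphM /= tofrac_eq => /eqP e.
apply/eqP; rewrite eqr_div ?tofrac_eq0 ?pshift_eq0 // -!tofracM tofrac_eq.
by rewrite -!pshiftM e.
Qed.

Lemma shift_tofrac j p : shift j p%:F = (pshift j p)%:F.
Proof.
have := shiftE j p (oner_neq0 _).
by rewrite pshift1 rmorph1 !divr1.
Qed.

Lemma shift_htilde j i : shift j (htilde i)%:F = (htilde i)%:F - (i == j)%:R.
Proof. by rewrite shift_tofrac pshift_htilde rmorphB rmorph_nat. Qed.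

Lemma shift_polyC j (c : K) : shift j (c%:MP)%:F = (c%:MP)%:F.
Proof. by rewrite shift_tofrac /pshift comp_mpolyC. Qed.

Lemma shiftD j : {morph shift j : x y / x + y}.
Proof.
move=> x y; rewrite (frac_repr x) (frac_repr y).
have x0 := denom_ratioP (repr x); have y0 := denom_ratioP (repr y).
rewrite addf_div ?tofrac_eq0 // -!tofracM -tofracD !shiftE ?mulf_neq0 //.
by rewrite pshiftD !pshiftM tofracD !tofracM addf_div // tofrac_eq0 pshift_eq0.
Qed.

Lemma shiftM j : {morph shift j : x y / x * y}.
Proof.
move=> x y; rewrite (frac_repr x) (frac_repr y).
have x0 := denom_ratioP (repr x); have y0 := denom_ratioP (repr y).
rewrite mulf_div -!tofracM !shiftE ?mulf_neq0 //.
by rewrite !pshiftM !tofracM mulf_div.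
Qed.

Lemma Ubar_shift j x : Ubar x -> Ubar (shift j x).
Proof.
move=> [p [q [dq ->]]]; exists (pshift j p), (pshift j q).
by split; [exact: denom_pshift | rewrite shiftE // denom_neq0].
Qed.

End Localization.

(* Main.v *)
(* The system forces [Delta_j sigma_i = Delta_i sigma_j] and, for [i != j],
   [sigma_j = Delta_j ((1 - h_ij) sigma_i)].  So the family is closed and every
   component is exact in its own direction, and [sigma] is built one direction
   at a time.  If [Delta_i s = sigma_i] for [i] in [I], the error
   [f = sigma_k - Delta_k s = Delta_k t] is independent of the [h_i], [i] in
   [I], and it suffices to make [t] independent of them too.  When some [l] is
   neither in [I] nor equal to [k], substituting [h_i := h_l + c] in [t] for
   generic integers [c] does this, and its only new poles are again of the form
   [h_ab + integer].  Otherwise [f] depends on [h_k] only; substituting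
   [h_i := h_k + c] for all [i] makes its denominator constant, so [f] is a
   polynomial in [h_k] and has a polynomial antidifference. *)
Require Import Defs.
From HB Require Import structures.
From mathcomp Require Import all_boot all_order all_algebra.
From mathcomp Require Import fraction mpoly ring zify.

Set Implicit Arguments.
Unset Strict Implicit.
Unset Printing Implicit Defensive.

Import GRing.Theory.
Local Open Scope ring_scope.

(** * Substitution endomorphisms and how they commute with shifts *)

Section Substitution.
Variables (K : fieldType) (n : nat).
Local Notation U := {mpoly K[n]}.
Local Notation h := (@htilde K n).
Implicit Types (p q w : U) (u v : 'I_n -> U) (i j k l : 'I_n).

Lemma mpoly_rmorph_eq (S : nzRingType) (f g : {rmorphism U -> S}) :
  (forall c, f c%:MP = g c%:MP) -> (forall i, f (h i) = g (h i)) -> f =1 g.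
Proof.
move=> eC eX; elim/mpolyind=> [|c m p _ _ IH]; first by rewrite !rmorph0.
rewrite !rmorphD /= IH -mul_mpolyC !rmorphM /= eC mpolyXE_id !rmorph_prod /=.
by congr (_ * _ + _); apply: eq_bigr => i _; rewrite !rmorphXn /= eX.
Qed.

(** Indexed by functions rather than tuples, so that shifts, partial substitutions and their
    composites are compared variable by variable through [eq_subst]. *)
Definition subst v p : U := p \mPo [tuple v i | i < n].

HB.instance Definition _ v := GRing.RMorphism.copy (subst v)
  (comp_mpoly [tuple v i | i < n]).

Lemma substC v c : subst v c%:MP = c%:MP.
Proof. exact: comp_mpolyC. Qed.

Lemma substX v i : subst v (h i) = v i.
Proof. by rewrite /subst comp_mpolyXU -tnth_nth tnth_mktuple. Qed.

Lemma subst_subst u v p : subst u (subst v p) = subst (subst u \o v) p.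
Proof.
apply: (@mpoly_rmorph_eq _ (subst u \o subst v)%FUN (subst _)) p.
  by move=> c /=; rewrite !substC.
by move=> i /=; rewrite !substX.
Qed.

Lemma eq_subst u v p : u =1 v -> subst u p = subst v p.
Proof.
move=> e; apply: (@mpoly_rmorph_eq _ (subst u) (subst v)) p => x.
  by rewrite /= !substC.
by rewrite /= !substX.
Qed.

Lemma subst_id p : subst h p = p.
Proof.
apply: (@mpoly_rmorph_eq _ (subst h) idfun) p => x; first by rewrite /= substC.
by rewrite /= substX.
Qed.

Definition upd i w j : U := if j == i then w else h j.

Lemma pshiftE j p : pshift j p = subst (fun i => h i - (i == j)%:R) p.
Proof. by []. Qed.

Lemma pshiftC i j p : pshift i (pshift j p) = pshift j (pshift i p).
Proof.
rewrite !pshiftE !subst_subst; apply: eq_subst => k /=.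
by rewrite !rmorphB /= !substX !rmorph_nat addrAC.
Qed.

Lemma pshift_upd m i w p : m != i -> pshift m w = w ->
  pshift m (subst (upd i w) p) = subst (upd i w) (pshift m p).
Proof.
move=> mi ew; rewrite !pshiftE !subst_subst; apply: eq_subst => j /=.
rewrite rmorphB /= substX rmorph_nat /upd; case: eqP => [->|_].
  by rewrite -pshiftE ew eq_sym (negPf mi) subr0.
by rewrite /= substX.
Qed.

Lemma pshift_upd_id i w p : pshift i w = w ->
  pshift i (subst (upd i w) p) = subst (upd i w) p.
Proof.
move=> ew; rewrite pshiftE subst_subst; apply: eq_subst => j /=.
rewrite /upd; case: eqP => [_|/eqP ji]; first by rewrite -pshiftE.
by rewrite substX (negPf ji) subr0.
Qed.

End Substitution.

(** * From invariance under a unit shift to independence of a variable *)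

Section Invariance.
Variables (K : fieldType) (n : nat).
Hypothesis charK0 : [pchar K] =i pred0.
Local Notation U := {mpoly K[n]}.
Local Notation h := (@htilde K n).
Implicit Types (p q w : U) (i j k l : 'I_n).

Lemma natrU_eq0 m : (m%:R == 0 :> U) = (m == 0)%N.
Proof.
by rewrite -(rmorph_nat (@mpolyC n K)) mpolyC_eq0; apply/pcharf0P: m.
Qed.

Lemma natrU_inj : injective (fun m => m%:R : U).
Proof.
move=> a b; wlog ab : a b / (a <= b)%N => [W e|/esym/eqP].
  by case/orP: (leq_total a b) => ?; [|symmetry]; apply: W.
by rewrite -subr_eq0 -natrB // natrU_eq0 => /eqP; lia.
Qed.

(** Packs all translates of [p] in direction [i] into one univariate polynomial over [U], so that
    roots can be counted. *)
Lemma subst_line i p :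
  exists P : {poly U}, forall x, P.[x] = subst (upd i (h i - x)) p.
Proof.
pose line : U -> {poly U} :=
  mmap (@polyC U \o @mpolyC n K) (fun j => (h j)%:P - (j == i)%:R * 'X).
exists (line p) => x.
apply: (@mpoly_rmorph_eq _ _ _ (horner_eval x \o line)%FUN (subst _)) p; [move=> c | move=> j] => /=.
  by rewrite substC /line mmapC /horner_eval hornerC.
rewrite substX /line mmapX mmap1U /horner_eval /upd.
rewrite hornerD hornerN hornerC -polyC_natr hornerCM hornerX.
by case: eqP => [->|_]; rewrite ?mul1r // mul0r subr0.
Qed.

(* Shift invariance by all natural numbers is a polynomial identity with
   infinitely many solutions, hence holds for every translation. *)
Lemma shift_inv_subst i w p q : q != 0 ->
  pshift i p * q = p * pshift i q ->
  subst (upd i w) p * q = p * subst (upd i w) q.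
Proof.
move=> q0 e1.
have e m : subst (upd i (h i - m%:R)) p * q = p * subst (upd i (h i - m%:R)) q.
  elim: m => [|m IH].
    rewrite subr0; have E : upd i (h i) =1 h by move=> j; rewrite /upd; case: eqP => [->|].
    by rewrite !(eq_subst _ E) !subst_id.
  have S r : subst (upd i (h i - m.+1%:R)) r =
      pshift i (subst (upd i (h i - m%:R)) r).
    rewrite pshiftE subst_subst; apply: eq_subst => j; rewrite /upd /=.
    case: eqP => [_|/eqP ji]; last by rewrite substX (negPf ji) subr0.
    by rewrite rmorphB rmorph_nat /= substX eqxx -natr1 opprD [in RHS]addrAC addrA.
  (* The shifted induction hypothesis involves [pshift i p] and [pshift i q]; [e1] trades them for
     [p] and [q] after multiplication by the nonzero [pshift i q]. *)
  rewrite !S; move: IH => /(congr1 (pshift i)); rewrite !pshiftM => IH.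
  have qi0 : pshift i q != 0 by rewrite pshift_eq0.
  apply: (mulIf qi0); rewrite mulrAC IH mulrAC e1 -!mulrA; congr (_ * _).
  exact: mulrC.
have [Pp Ep] := subst_line i p; have [Pq Eq] := subst_line i q.
pose P := Pp * q%:P - p%:P * Pq.
have PE x : P.[x] = subst (upd i (h i - x)) p * q - p * subst (upd i (h i - x)) q.
  by rewrite hornerD hornerN !hornerM !hornerC Ep Eq.
have P0 : P = 0.
  (* In characteristic 0 the naturals below [size P] are distinct roots, too many for a nonzero
     [P]. *)
  apply: (@roots_geq_poly_eq0 _ P [seq m%:R | m <- iota 0 (size P)]).
  - by apply/allP=> _ /mapP[m _ ->]; rewrite /root PE (e m) subrr.
  - by rewrite map_inj_uniq ?iota_uniq //; apply: natrU_inj.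
  - by rewrite size_map size_iota.
have := PE (h i - w); rewrite P0 horner0 => /esym/eqP.
by rewrite subr_eq0 subKr => /eqP.
Qed.

End Invariance.

(** * Denominators with a restricted set of variables *)

Section Denominators.
Variables (K : fieldType) (n : nat).
Hypothesis charK0 : [pchar K] =i pred0.
Local Notation U := {mpoly K[n]}.
Local Notation h := (@htilde K n).
Implicit Types (p q w : U) (i j k l : 'I_n) (J : pred 'I_n).

(** Records which variables may occur: clearing variables one by one shrinks [J], and over a single
    index only 1 is left. *)
Inductive denom_on J : U -> Prop :=
| denom_on1 : denom_on J 1
| denom_onM i j (a : int) q : J i -> J j -> i != j -> denom_on J q ->
    denom_on J ((hdiff K i j + a%:~R) * q).

Lemma denom_onW J q : denom_on J q -> denom q.
Proof. by elim=> [|i j a {}q _ _ ij _ dq]; [apply: denom1 | apply: denomM]. Qed.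

Lemma denom_onT q : denom q -> denom_on predT q.
Proof. by elim=> [|i j a {}q ij _ dq]; [apply: denom_on1 | apply: denom_onM]. Qed.

Lemma eq_denom_on J1 J2 q : J1 =1 J2 -> denom_on J1 q -> denom_on J2 q.
Proof.
move=> e; elim=> [|i j a {}q Ji Jj ij _ dq]; first exact: denom_on1.
by apply: denom_onM; rewrite -?e.
Qed.

Lemma denom_on_pred1 k q : denom_on (pred1 k) q -> q = 1.
Proof. by elim=> // i j a {}q /eqP-> /eqP->; rewrite eqxx. Qed.

Lemma intrK_eq0 (a : int) : (a%:~R == 0 :> K) = (a == 0).
Proof.
have natr0 m : (m%:R == 0 :> K) = (m == 0)%N by apply/pcharf0P: m.
by case: a => m; rewrite ?NegzE ?mulrNz ?oppr_eq0 -pmulrn natr0.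
Qed.

(* For all large [c], the substitution [X_i := X_l + c] meets no pole of
   [1 / q]; the factors [X_i - X_l + a] become the nonzero constants [c + a]. *)
Lemma denom_on_subst J i l q : J l -> l != i -> denom_on J q ->
  exists N : nat, forall c : nat, (N <= c)%N ->
    exists kappa d, [/\ kappa != 0, denom_on (predD1 J i) d &
      subst (upd i (h l + c%:R)) q = kappa%:MP * d].
Proof.
move=> Jl li; elim=> [|a b z {}q Ja Jb ab _ [N IH]].
  by exists 0%N => c _; exists 1, 1; split; rewrite ?oner_neq0 ?rmorph1 ?mulr1 //;
    apply: denom_on1.
(* This bound forces [c > |z|], so the constants [c + z] and [z - c] are nonzero. *)
exists (N + `|z|.+1)%N => c Nc.
have [|kap [d [kap0 dd ed]]] := IH c; first by lia.
have factor : subst (upd i (h l + c%:R)) (hdiff K a b + z%:~R) =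
    upd i (h l + c%:R) a - upd i (h l + c%:R) b + z%:~R.
  by rewrite rmorphD rmorphB /= !substX rmorph_int.
(* A factor of [q] either becomes a nonzero constant, absorbed in [kappa] ([con]), or stays a
   shifted difference of two variables other than [h i], kept in [d] ([var]). *)
have con (e : int) : e != 0 ->
  subst (upd i (h l + c%:R)) (hdiff K a b + z%:~R) = e%:~R ->
  exists kappa d, [/\ kappa != 0, denom_on (predD1 J i) d &
   subst (upd i (h l + c%:R)) ((hdiff K a b + z%:~R) * q) = kappa%:MP * d].
  move=> e0 ee; exists (e%:~R * kap), d; split=> //.
    by rewrite mulf_neq0 ?intrK_eq0.
  by rewrite rmorphM /= ee ed mulrA rmorphM rmorph_int.
have var a' b' (e : int) : J a' -> J b' -> a' != i -> b' != i -> a' != b' ->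
  subst (upd i (h l + c%:R)) (hdiff K a b + z%:~R) = hdiff K a' b' + e%:~R ->
  exists kappa d, [/\ kappa != 0, denom_on (predD1 J i) d &
   subst (upd i (h l + c%:R)) ((hdiff K a b + z%:~R) * q) = kappa%:MP * d].
  move=> Ja' Jb' a'i b'i a'b' ee.
  exists kap, ((hdiff K a' b' + e%:~R) * d); split=> //.
    by apply: denom_onM => //=; apply/andP.
  by rewrite rmorphM /= ee ed mulrCA.
rewrite /upd in factor.
have [ai|ai] := eqVneq a i; have [bi|bi] := eqVneq b i.
- by rewrite ai bi eqxx in ab.
- rewrite ai eqxx (negPf bi) in factor.
  have [bl|bl] := eqVneq b l.
    apply: (con (c%:Z + z)); first by lia.
    by rewrite ai factor bl rmorphD /= -pmulrn; ring.
  apply: (var l b (c%:Z + z)) => //; first by rewrite eq_sym.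
  by rewrite ai factor rmorphD /= -pmulrn /hdiff; ring.
- rewrite bi eqxx (negPf ai) in factor.
  have [al|al] := eqVneq a l.
    apply: (con (z - c%:Z)); first by lia.
    by rewrite bi factor al rmorphB /= -pmulrn; ring.
  apply: (var a l (z - c%:Z)) => //.
  by rewrite bi factor rmorphB /= -pmulrn /hdiff; ring.
- rewrite (negPf ai) (negPf bi) in factor.
  exact: (var a b z).
Qed.

End Denominators.

(** * Antidifferences of polynomials in [h k] *)

Section Antidifference.
Variables (K : fieldType) (n : nat).
Hypothesis charK0 : [pchar K] =i pred0.
Local Notation U := {mpoly K[n]}.
Local Notation h := (@htilde K n).
Variable k : 'I_n.
Implicit Types (p q : U).

Let summable p :=
  exists2 g, g - pshift k g = p & forall i, i != k -> pshift i g = g.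

Let summableZ (c : K) p : summable p -> summable (c%:MP * p).
Proof.
move=> [g <- gi]; exists (c%:MP * g) => [|i ik]; rewrite pshiftM pshiftE substC.
  by rewrite mulrBr.
by rewrite gi.
Qed.

Let summableD p q : summable p -> summable q -> summable (p + q).
Proof.
move=> [g <- gi] [f <- fi]; exists (g + f) => [|i ik]; rewrite pshiftD.
  by rewrite opprD addrACA.
by rewrite gi ?fi.
Qed.

(** Rising factorials play the role of monomials: the backward difference of [rising m.+1] is
    [(m + 1) * rising m]. *)
Let rising m : U := \prod_(r < m) (h k + r%:R).

Let pshift_rising m : pshift k (rising m.+1) = (h k - 1) * rising m.
Proof.
rewrite /rising big_ord_recl addr0 pshiftM pshift_htilde eqxx; congr (_ * _).
rewrite pshiftE rmorph_prod; apply: eq_bigr => r _ /=.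
by rewrite rmorphD rmorph_nat /= substX eqxx /bump add1n -natr1 [_ + 1]addrC addrA subrK.
Qed.

Let summable_rising m : summable (rising m).
Proof.
have m0 : m.+1%:R != 0 :> K by move/pcharf0P: charK0 => ->.
have -> : rising m = (m.+1%:R^-1)%:MP * (m.+1%:R%:MP * rising m).
  by rewrite mulrA -mpolyCM mulVf // mpolyC1 mul1r.
apply: summableZ; exists (rising m.+1) => [|i ik].
  rewrite pshift_rising /rising big_ord_recr /= rmorph_nat -natr1; ring.
rewrite pshiftE rmorph_prod; apply: eq_bigr => r _ /=.
by rewrite rmorphD rmorph_nat /= substX eq_sym (negPf ik) subr0.
Qed.

(** Writing one factor [h k] as [(h k + m) - m] lowers [d] and raises [m], which reduces powers to
    rising factorials. *)
Let summable_Xn d m : summable (h k ^+ d * rising m).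
Proof.
elim: d m => [|d IH] m; first by rewrite mul1r; apply: summable_rising.
have -> : h k ^+ d.+1 * rising m =
    h k ^+ d * rising m.+1 + (- m%:R)%:MP * (h k ^+ d * rising m).
  rewrite /rising big_ord_recr /= rmorphN rmorph_nat exprS; ring.
by apply: summableD; [|apply: summableZ]; apply: IH.
Qed.

(** A polynomial in [h k] alone is encoded as the image of some [p] under sending every variable to
    [h k]. *)
Lemma antidifference p : exists2 g, g - pshift k g = subst (fun=> h k) p &
  forall i, i != k -> pshift i g = g.
Proof.
rewrite -/(summable _); elim/mpolyind: p => [|c m p _ _ IH].
  by exists 0 => [|i _]; rewrite pshift0 ?subr0 ?rmorph0.
rewrite rmorphD; apply: summableD => //.
rewrite -mul_mpolyC rmorphM /= substC; apply: summableZ.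
have -> : subst (fun=> h k) 'X_[m] = h k ^+ (\sum_i m i) * rising 0.
  rewrite mpolyXE_id rmorph_prod /rising big_ord0 mulr1 -prodrXr.
  by apply: eq_bigr => i _; rewrite rmorphXn /= substX.
exact: summable_Xn.
Qed.

End Antidifference.

(** * Difference operators on fractions and their controlled preimages *)

Section Exactness.
Variables (K : fieldType) (n : nat).
Hypothesis charK0 : [pchar K] =i pred0.
Local Notation U := {mpoly K[n]}.
Local Notation FU := {fraction {mpoly K[n]}}.
Local Notation h := (@htilde K n).
Implicit Types (p q w a b : U) (x y f t : FU) (i j k l m : 'I_n).

Lemma shift0 i : shift i 0 = 0 :> FU.
Proof. by rewrite -tofrac0 shift_tofrac pshift0. Qed.

Lemma shiftN i : {morph @shift K n i : x / - x}.
Proof.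
by move=> x; apply/eqP; rewrite -subr_eq0 opprK -shiftD addNr shift0.
Qed.

Lemma DeltaD i : {morph @Delta K n i : x y / x + y}.
Proof. by move=> x y; rewrite /Delta shiftD opprD addrACA. Qed.

Lemma DeltaN i : {morph @Delta K n i : x / - x}.
Proof. by move=> x; rewrite /Delta shiftN opprD. Qed.

Lemma DeltaB i : {morph @Delta K n i : x y / x - y}.
Proof. by move=> x y; rewrite DeltaD DeltaN. Qed.

Lemma DeltaC i j x : Delta i (Delta j x) = Delta j (Delta i x).
Proof.
have C p q : q != 0 ->
    shift i (shift j (p%:F / q%:F)) = shift j (shift i (p%:F / q%:F)).
  move=> q0; have E k l : shift k (shift l (p%:F / q%:F)) =
      (pshift k (pshift l p))%:F / (pshift k (pshift l q))%:F.
    apply: etrans (congr1 (shift k) (shiftE l p q0)) (shiftE k _ _).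
    by rewrite pshift_eq0.
  apply: etrans (E i j) (etrans _ (esym (E j i))).
  by rewrite (pshiftC i j p) (pshiftC i j q).
have G (V : zmodType) (u a b c : V) : u - a - (b - c) = u - b - (a - c).
  by rewrite !opprB addrACA [RHS]addrACA [- a - b]addrC.
rewrite /Delta !shiftD !shiftN (frac_repr x) C; first exact: G.
exact: denom_ratioP.
Qed.

Lemma Ubar_Delta i x : Ubar x -> Ubar (Delta i x).
Proof. by move=> Ux; apply/UbarD/UbarN/Ubar_shift. Qed.

(** Clearing denominators gives a polynomial identity, to which [subst] applies even though it does
    not extend to all fractions. *)
Lemma Delta_fracE k p q a b : q != 0 -> b != 0 ->
  Delta k (p%:F / q%:F) = a%:F / b%:F <->
  (p * pshift k q - pshift k p * q) * b = a * (q * pshift k q).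
Proof.
move=> q0 b0; have qk0 : pshift k q != 0 by rewrite pshift_eq0.
rewrite /Delta shiftE // -mulNr -rmorphN addf_div ?tofrac_eq0 //.
rewrite -!tofracM -tofracD mulNr; split=> [/eqP|e].
  by rewrite eqr_div ?tofrac_eq0 ?mulf_neq0 // -!tofracM tofrac_eq => /eqP.
by apply/eqP; rewrite eqr_div ?tofrac_eq0 ?mulf_neq0 // -!tofracM e.
Qed.

Lemma Delta_frac0 k p q : q != 0 ->
  Delta k (p%:F / q%:F) = 0 <-> pshift k p * q = p * pshift k q.
Proof.
move=> q0; have := Delta_fracE k p 0 q0 (oner_neq0 _).
rewrite tofrac0 !mul0r mulr1 => ->; split=> [/eqP|->]; last by rewrite subrr.
by rewrite subr_eq0 => /eqP ->.
Qed.

Lemma Delta_subst_frac i w p q : q != 0 -> subst (upd i w) q != 0 ->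
  Delta i (p%:F / q%:F) = 0 ->
  p%:F / q%:F = (subst (upd i w) p)%:F / (subst (upd i w) q)%:F.
Proof.
move=> q0 qw0 /(Delta_frac0 _ _ q0) /(shift_inv_subst charK0 w q0) e.
by apply/eqP; rewrite eqr_div ?tofrac_eq0 // -!tofracM -e mulrC.
Qed.

(** The generators of [denom] carry no scalar factor, so the constant from [denom_on_subst] is moved
    to the numerator. *)
Lemma frac_scale (c : K) p q : c != 0 -> q != 0 ->
  p%:F / (c%:MP * q)%:F = (c^-1%:MP * p)%:F / q%:F.
Proof.
move=> c0 q0; apply/eqP; rewrite eqr_div ?tofrac_eq0 ?mulf_neq0 ?mpolyC_eq0 //.
by rewrite -!tofracM mulrACA -mpolyCM mulVf // mpolyC1 mul1r.
Qed.

(* Substituting [X_i := X_l + c] in [t] for a generic integer [c] preserves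
   [Ubar] and commutes with [Delta m] for [m] distinct from [i] and [l]. *)
Lemma Delta_preimage_clear i k l f t :
  i != k -> l != i -> l != k -> Ubar f -> Ubar t ->
  Delta k t = f -> Delta i f = 0 ->
  exists t', [/\ Ubar t', Delta k t' = f, Delta i t' = 0 &
    forall m, m != l -> Delta m t = 0 -> Delta m t' = 0].
Proof.
move=> ik li lk [a [b [db ->]]] [p [q [dq ->]]] ekt eif.
have [N1 H1] := denom_on_subst charK0 (J := predT) isT li (denom_onT dq).
have [N2 H2] := denom_on_subst charK0 (J := predT) isT li (denom_onT db).
(* One [c] has to avoid the poles of both [t] and [f]. *)
pose c := maxn N1 N2; have {H1} := H1 c (leq_maxl _ _).
have {H2} := H2 c (leq_maxr _ _).
set v := upd i _ => -[k2 [d2 [k20 dd2 e2]]] [k1 [d1 [k10 dd1 e1]]].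
have q0 := denom_neq0 dq; have b0 := denom_neq0 db.
have qv0 : subst v q != 0.
  by rewrite e1 mulf_neq0 ?mpolyC_eq0 // (denom_neq0 (denom_onW dd1)).
have bv0 : subst v b != 0.
  by rewrite e2 mulf_neq0 ?mpolyC_eq0 // (denom_neq0 (denom_onW dd2)).
have w_inv m : m != l -> pshift m (h l + c%:R) = h l + c%:R.
  by move=> ml; rewrite pshiftE rmorphD rmorph_nat /= substX eq_sym (negPf ml) subr0.
have ev m r : m != i -> m != l -> subst v (pshift m r) = pshift m (subst v r).
  by move=> mi ml; rewrite pshift_upd // w_inv.
exists ((subst v p)%:F / (subst v q)%:F); split.
- exists (k1^-1%:MP * subst v p), d1; split; first exact: denom_onW dd1.
  by rewrite e1 frac_scale // (denom_neq0 (denom_onW dd1)).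
(* Since [f] is independent of [h i], it equals its own substituted form, and the cleared equation
   for [t] can be substituted on both sides. *)
- rewrite (Delta_subst_frac (w := h l + c%:R) b0 bv0 eif).
  move/(Delta_fracE _ _ _ q0 b0): ekt => /(congr1 (subst v)).
  rewrite !(rmorphM, rmorphB) /= !ev; try by rewrite eq_sym.
  by move/(Delta_fracE _ _ _ qv0 bv0).
- apply/(Delta_frac0 i (subst v p) qv0).
  by rewrite !pshift_upd_id // w_inv // eq_sym.
move=> m ml /(Delta_frac0 m p q0) e; apply/(Delta_frac0 m (subst v p) qv0).
have [->|mi] := eqVneq m i.
  by rewrite !pshift_upd_id // w_inv // eq_sym.
by rewrite -(ev m p mi ml) -(ev m q mi ml) -2!rmorphM e.
Qed.

(** The same target [l] serves for every variable in [s]; as [l] is outside [s], each new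
    substitution preserves the independence already gained. *)
Lemma Delta_preimage_clear_seq k l f t (s : seq 'I_n) :
  k \notin s -> l \notin s -> l != k -> Ubar f -> Ubar t ->
  Delta k t = f -> (forall i, i \in s -> Delta i f = 0) ->
  exists t', [/\ Ubar t', Delta k t' = f & forall i, i \in s -> Delta i t' = 0].
Proof.
move=> + + lk Uf Ut et; elim: s => [|i s IH]; first by exists t.
rewrite !inE !negb_or => /andP[ki ks] /andP[li ls] ef.
have [t1 [Ut1 et1 t10]] := IH ks ls (fun j js => ef j (mem_behead (s := i :: s) js)).
have [|t2 [Ut2 et2 it2 t20]] :=
    @Delta_preimage_clear i k l f t1 _ li lk Uf Ut1 et1 (ef i (mem_head _ _)).
  by rewrite eq_sym.
exists t2; split; [exact: Ut2 | exact: et2 | move=> j].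
rewrite inE => /predU1P[->|js]; first exact: it2.
by apply: t20; [apply: contraNneq ls => <- | apply: t10].
Qed.

(** Substituting [h i := h k + N] does not change [f], but removes [h i] from its denominator. *)
Lemma Delta_inv_denom_on k f (s : seq 'I_n) :
  k \notin s -> Ubar f -> (forall i, i \in s -> Delta i f = 0) ->
  exists p q, denom_on [predC s] q /\ f = p%:F / q%:F.
Proof.
move=> + Uf; elim: s => [_ _|i s IH].
  by have [p [q [dq ->]]] := Uf; exists p, q; split=> //; apply: eq_denom_on (denom_onT dq).
rewrite inE negb_or => /andP[ki ks] ef.
have [p [q [dq e]]] := IH ks (fun j js => ef j (mem_behead (s := i :: s) js)).
have [N /(_ N (leqnn _))] := denom_on_subst charK0 (J := [predC s]) ks ki dq.
move=> [c [d [c0 dd eq]]].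
have if0 := ef i (mem_head _ _); rewrite e in if0 *.
exists (c^-1%:MP * subst (upd i (h k + N%:R)) p), d; split.
  by apply: eq_denom_on dd => j /=; rewrite !inE negb_or.
rewrite (Delta_subst_frac (w := h k + N%:R) (denom_neq0 (denom_onW dq)) _ if0).
  by rewrite eq frac_scale // (denom_neq0 (denom_onW dd)).
by rewrite eq mulf_neq0 ?mpolyC_eq0 // (denom_neq0 (denom_onW dd)).
Qed.

Lemma Delta_preimage_univariate k f :
  Ubar f -> (forall i, i != k -> Delta i f = 0) ->
  exists g, [/\ Ubar g, Delta k g = f & forall i, i != k -> Delta i g = 0].
Proof.
move=> Uf ef; pose s := rem k (enum 'I_n).
have sE i : (i \in s) = (i != k) by rewrite mem_rem_uniq ?enum_uniq // !inE mem_enum andbT.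
have [||p [q [dq ep]]] := @Delta_inv_denom_on k f s _ Uf.
- by rewrite sE eqxx.
- by move=> i; rewrite sE => /ef.
have q1 : q = 1.
  by apply: (@denom_on_pred1 K n k); apply: eq_denom_on dq => i; rewrite /= sE negbK.
have fp : f = p%:F / 1%:F by rewrite ep q1.
have pk : subst (fun=> h k) p = p.
  have inv i : i != k -> subst (upd i (h k)) p = p.
    move=> /ef; rewrite fp => /(Delta_frac0 _ _ (oner_neq0 _)).
    move=> /(shift_inv_subst charK0 (h k) (oner_neq0 _)).
    by rewrite rmorph1 !mulr1.
  (* The variables are replaced by [h k] one at a time, each by invariance of [p]. *)
  have invs (r : seq 'I_n) : {subset r <= s} ->
      subst (fun j => if j \in r then h k else h j) p = p.
    elim: r => [_|i r IH rs]; first exact: subst_id.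
    have ik : i != k by rewrite -sE rs ?mem_head.
    rewrite -[RHS]IH; last by move=> j jr; rewrite rs // inE jr orbT.
    rewrite -[in RHS](inv i ik) subst_subst; apply: eq_subst => j /=.
    rewrite inE /upd; case: eqP => _; last by rewrite /= substX.
    by rewrite substX; case: ifP.
  rewrite -[RHS](invs s) //; apply: eq_subst => j; rewrite sE.
  by case: eqVneq => [->|].
have [g gk gi] := antidifference charK0 k p.
have Dg i : Delta i g%:F = (g - pshift i g)%:F by rewrite /Delta shift_tofrac tofracB.
exists g%:F; split; first exact: Ubar_tofrac.
  by rewrite Dg gk pk fp tofrac1 divr1.
by move=> i ik; rewrite Dg gi // subrr tofrac0.
Qed.

(** Either some [l] outside [s] and distinct from [k] can receive the variables of [s], or [s]
    contains all indices but [k] and [f] is univariate. *)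
Lemma Delta_preimage k f t (s : seq 'I_n) :
  k \notin s -> Ubar f -> Ubar t -> Delta k t = f ->
  (forall i, i \in s -> Delta i f = 0) ->
  exists g, [/\ Ubar g, Delta k g = f & forall i, i \in s -> Delta i g = 0].
Proof.
move=> ks Uf Ut et ef.
have [/existsP[l /andP[lk ls]]|/existsPn full] := boolP [exists l, (l != k) && (l \notin s)].
  exact: (Delta_preimage_clear_seq ks ls lk Uf Ut et ef).
have sE i : i != k -> i \in s by move=> ik; move: (full i); rewrite ik negbK.
have [g [Ug gk gi]] := Delta_preimage_univariate Uf (fun i ik => ef i (sE i ik)).
by exists g; split=> // i si; apply: gi; apply: contraNneq ks => <-.
Qed.

End Exactness.

(** * Closedness, exactness in each direction, and gluing *)

Theorem proposition3p6 (K : fieldType) (charK0 : [pchar K] =i pred0)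
    (n : nat) (n_ge1 : (1 <= n)%N)
    (sigma : 'I_n -> {fraction {mpoly K[n]}})
    (sigmaU : forall i : 'I_n, Ubar (sigma i))
    (sigma_sys : forall i j : 'I_n,
      (hdiff K i j)%:F * Delta j (sigma i) = sigma i - sigma j) :
  exists s : {fraction {mpoly K[n]}},
    Ubar s /\ forall i : 'I_n, sigma i = Delta i s.
Proof.
have hN i j : (hdiff K j i)%:F = - (hdiff K i j)%:F :> {fraction {mpoly K[n]}}.
  by rewrite -tofracN /hdiff opprB.
have closed i j : Delta j (sigma i) = Delta i (sigma j).
  have [->//|ij] := eqVneq i j.
  have h0 : (hdiff K i j)%:F != 0 :> {fraction {mpoly K[n]}}.
    have := denom_neq0 (@denomM K n i j 0 1 ij (denom1 _ _)).
    by rewrite tofrac_eq0 addr0 mulr1.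
  (* Exchanging [i] and [j] changes the sign of both [hdiff K i j] and [sigma i - sigma j]. *)
  apply: (mulfI h0); rewrite sigma_sys -[RHS]opprK -mulNr -hN sigma_sys.
  by rewrite opprB.
have exact1 k : exists2 t, Ubar t & Delta k t = sigma k.
  have [/existsP[i ik]|/existsPn alone] := boolP [exists i, i != k].
    (* The shift sends [1 - H] to [-H], with [H] the fraction of [hdiff K i k], so [Delta k] of the
       product is [sigma i - H * Delta k (sigma i)], which is [sigma k] by the system. *)
    exists ((1 - (hdiff K i k)%:F) * sigma i).
      by apply: UbarM => //; rewrite -tofrac1 -tofracB; apply: Ubar_tofrac.
    have sH : shift k (1 - (hdiff K i k)%:F) = - (hdiff K i k)%:F.
      rewrite -tofrac1 -tofracB shift_tofrac -tofracN; congr tofrac.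
      rewrite pshiftE !rmorphB rmorph1 /= !substX (negPf ik) eqxx subr0.
      by rewrite /hdiff !opprB addrA [1 + _]addrC subrK.
    have G (R : comNzRingType) (H x y : R) :
      (1 - H) * x - - H * y = x - H * (x - y) by ring.
    by rewrite /Delta shiftM sH G -/(Delta k _) sigma_sys subKr.
  have [i ik|g [Ug gk _]] := @Delta_preimage_univariate K n charK0 k _ (sigmaU k).
    by move: (alone i); rewrite ik.
  by exists g.
suff [x [Ux ex]] : exists x, Ubar x /\ forall i, i \in enum 'I_n -> sigma i = Delta i x.
  by exists x; split=> // i; apply: ex; rewrite mem_enum.
elim: (enum 'I_n) (enum_uniq 'I_n) => [_|k s IH /= /andP[ks /IH[x [Ux ex]]]].
  by exists 0; split=> //; rewrite -tofrac0; apply: Ubar_tofrac.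
have [t Ut et] := exact1 k.
(* The error in direction [k] has antidifference [t - x], and [Delta i] kills it for [i] in [s] by
   closedness and commutation of differences. *)
have [||||g [Ug gk gs]] := @Delta_preimage K n charK0 k (sigma k - Delta k x) (t - x) s ks.
- by apply/UbarD/UbarN/Ubar_Delta.
- exact/UbarD/UbarN.
- by rewrite DeltaB et.
- by move=> i si; rewrite DeltaB closed (ex i si) DeltaC subrr.
exists (x + g); split=> [|i]; first exact: UbarD.
rewrite inE DeltaD => /predU1P[->|si]; first by rewrite gk addrC subrK.
by rewrite gs // addr0 ex.
Qed.
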